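(* For $0<\epsilon\le 1/2$, $$L(\epsilon)=\frac{3}{\pi}+O\big(\sqrt{\epsilon}\,|\log\epsilon|\big),$$ with an absolute implied constant.
   Context: For a reduced fraction $a/q$ ($q\ge1$, $\gcd(a,q)=1$) the Ford circle $C_{a/q}$ is the circle in $\mathbb C$ with center $a/q+\frac{i}{2q^2}$ and radius $\frac{1}{2q^2}$ (tangent to the real axis at $a/q$); let $D_{a/q}$ be the open disk it bounds. Define $$L(\epsilon)=\sum_{\substack{1\le a\le q\\ \gcd(a,q)=1\\ q^2\le 1/\epsilon}}2\sqrt{r_q^2-(\epsilon-r_q)^2},\qquad r_q=\frac1{2q^2},$$ i.e. the total length of the intersections of the horizontal segment $\{x+i\epsilon\}$ with the Ford disks based at $a/q\in(0,1]$; equivalently, $L(\epsilon)$ is the Lebesgue measure of the set of $x\in[0,1]$ such that $x+i\epsilon$ lies in the union of all Ford disks $D_{a/q}$, $a/q\in\mathbb Q$. *)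

(* Defs.v *)
From mathcomp Require Import all_boot all_order all_algebra.
From mathcomp Require Import all_classical all_reals all_analysis.

Set Implicit Arguments.
Unset Strict Implicit.
Unset Printing Implicit Defensive.

Import Order.TTheory GRing.Theory Num.Theory.
Local Open Scope ring_scope.

Definition ford_radius (R : realType) (q : nat) : R := (2 * q%:R ^+ 2)^-1.

Definition chord_length (R : realType) (eps : R) (q : nat) : R :=
  2 * Num.sqrt (ford_radius R q ^+ 2 - (eps - ford_radius R q) ^+ 2).

(* The upper bound on q only makes the sum formally finite: see
   [ford_range_exhaustive]. *)
Definition ford_length (R : realType) (eps : R) : R :=
  \sum_(1 <= q < (Num.truncn eps^-1).+1 | q%:R ^+ 2 <= eps^-1)
    \sum_(1 <= a < q.+1 | coprime a q) chord_length eps q.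

Lemma ford_range_exhaustive (R : realType) (eps : R) (q : nat) :
  q%:R ^+ 2 <= eps^-1 -> (q < (Num.truncn eps^-1).+1)%N.
Proof.
move=> h; rewrite ltnS truncn_ge_nat; last by rewrite (le_trans _ h) ?sqr_ge0.
by rewrite (le_trans _ h)// -natrX ler_nat -mulnn; case: (q) => // n; rewrite leq_pmulr.
Qed.

(* Main.v *)
Require Import Defs.
From mathcomp Require Import all_boot all_order all_algebra.
From mathcomp Require Import all_classical all_reals all_analysis.
From mathcomp Require Import ring lra zify.

(* Put delta = sqrt(eps) and K = floor(1/eps). The chord of a Ford circle of
   denominator q is (2 delta / q) sqrt(1 - (delta q)^2), and there are
   phi(q) = sum_(d | q) mu(d) q / d of them, so
     L(eps) = 2 sum_(d <= K) mu(d) / d^2 * S(delta d),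
   where S(h) = sum_(m >= 1) h sqrt(1 - (h m)^2) is a Riemann sum of step h for
   the quarter disk, hence lies in [pi/4 - h, pi/4].  Inverting
   sum_(d <= K) mu(d) / d^2 * sum_(m <= K/d) 1/m^2 = 1 by means of
   sum_(m <= M) 1/m^2 = pi^2/6 + O(1/M) evaluates sum_(d <= K) mu(d) / d^2.
   Both errors are O(delta sum_(d <= K) 1/d) = O(delta |ln eps|).
   The rate in the Basel sum comes from sum_(1 <= k < N) 1/sin^2(k pi / 2N) =
   2/3 (N^2 - 1) for N a power of 2 and 1/sin^2 x - 1 <= 1/x^2 <= 1/sin^2 x. *)

Set Implicit Arguments.
Unset Strict Implicit.
Unset Printing Implicit Defensive.
Import Order.TTheory GRing.Theory Num.Theory numFieldNormedType.Exports.
Local Open Scope ring_scope.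

(** * Divisor sums and the Moebius function *)

Lemma sum_multiples (V : nmodType) (F : nat -> V) (d K : nat) : (0 < d)%N ->
  \sum_(1 <= n < K.+1 | (d %| n)%N) F n =
  \sum_(1 <= m < (K %/ d).+1) F (d * m)%N.
Proof.
move=> d0; elim: K => [|K IH]; first by rewrite div0n !big_geq.
rewrite big_mkcond big_nat_recr//= -big_mkcond IH divnS//.
case: ifPn => [dK|_]; last by rewrite addr0.
rewrite add1n [RHS]big_nat_recr//=.
by have := divnK dK; rewrite mulnC divnS// dK add1n => ->.
Qed.

Section Mobius.
Variable R : comPzRingType.

(** Written as a product of local factors so that multiplication by one prime is easy to track; a
    valuation of 2 or more gives the factor 0. *)
Definition mobius (n : nat) : R :=
  \prod_(p <- primes n) (if logn p n == 1 then -1 else 0).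

Lemma mobius1 : mobius 1 = 1.
Proof. by rewrite /mobius big_nil. Qed.

Lemma mobius_primeM (p n : nat) : prime p -> (0 < n)%N ->
  mobius (p * n) = if (p %| n)%N then 0 else - mobius n.
Proof.
move=> pp n0; have p0 := prime_gt0 pp.
have lognpM q : logn q (p * n) = ((p == q) + logn q n)%N.
  by rewrite lognM// logn_prime// eq_sym.
have [pn|pn] := boolP (p %| n)%N.
  have pin : p \in primes (p * n).
    by rewrite mem_primes pp muln_gt0 p0 n0 dvdn_mulr.
  have := logn_gt0 p n; rewrite mem_primes pp n0 pn => l0.
  rewrite /mobius (big_rem p)//= lognpM eqxx add1n eqSS.
  by rewrite -leqn0 leqNgt l0 mul0r.
have ln0 : logn p n = 0%N by apply/eqP; rewrite lognE pp n0/= (negbTE pn).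
have pe : perm_eq (primes (p * n)) (p :: primes n).
  apply: uniq_perm; rewrite ?primes_uniq//=.
    by rewrite mem_primes (negbTE pn) !andbF primes_uniq.
  by move=> q; rewrite primesM// primes_prime// !inE.
rewrite /mobius (perm_big _ pe) big_cons lognpM eqxx ln0/= mulN1r; congr (- _).
apply: eq_big_seq => q; rewrite lognpM mem_primes => /and3P[_ _ qn].
by case: (eqVneq p q) => [pq|//]; rewrite -pq (negbTE pn) in qn.
Qed.

(** Write n = p m with p the least prime factor. A divisor p d has weight - mu(d) if p does not
    divide d and 0 otherwise, so the multiples of p cancel the divisors prime to p. *)
Lemma sum_mobius_dvd (n : nat) : (0 < n)%N ->
  \sum_(1 <= d < n.+1 | (d %| n)%N) mobius d = (n == 1%N)%:R.
Proof.
move=> n0; have [->|n1] := eqVneq n 1%N.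
  by rewrite big_mkcond big_nat1 /= mobius1.
have pp : prime (pdiv n) by rewrite pdiv_prime// ltn_neqAle eq_sym n1.
move: (pdiv_dvd n); set p := pdiv n in pp * => pn.
have p0 := prime_gt0 pp.
have [m nE] : exists m, n = (p * m)%N by exists (n %/ p)%N; rewrite mulnC divnK.
have m0 : (0 < m)%N by move: n0; rewrite nE muln_gt0 => /andP[].
rewrite (bigID (fun d => (p %| d)%N))/=.
rewrite (eq_bigl (fun d => (p %| d) && (d %| n))%N); last by move=> d; rewrite andbC.
rewrite big_mkcondr sum_multiples//= nE mulKn//.
rewrite -[X in X + _]opprK -sumrN; apply/eqP; rewrite addrC subr_eq0; apply/eqP.
(* A divisor of p m prime to p divides m, which brings both halves to the range up to m. *)
have -> : \sum_(1 <= d < (p * m).+1 | ((d %| p * m) && ~~ (p %| d))%N) mobius d =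
  \sum_(1 <= d < m.+1 | ((d %| p * m) && ~~ (p %| d))%N) mobius d.
  rewrite [RHS](big_nat_widen _ _ (p * m).+1) ?ltnS ?leq_pmull//.
  apply: eq_bigl => d /=; case: (boolP (p %| d)%N) => [|pd]; first by rewrite !andbF.
  rewrite andbT; case: (boolP (d %| p * m)%N) => //=; rewrite Gauss_dvdr => [dm|].
    by rewrite ltnS dvdn_leq.
  by rewrite coprime_sym prime_coprime.
rewrite big_mkcond; apply: eq_big_nat => d /andP[d1 _].
rewrite dvdn_pmul2l// mobius_primeM//.
case: (boolP (p %| d)%N) => [|pd]; first by rewrite andbF; case: ifP; rewrite oppr0.
rewrite andbT Gauss_dvdr; first by case: ifP; rewrite ?opprK ?oppr0.
by rewrite coprime_sym prime_coprime.
Qed.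

(** Substitution n = d m in a double sum; it serves both for the Ford length and for inverting the
    Basel sum. *)
Lemma sum_multiples_exchange (F : nat -> nat -> R) (K : nat) :
  \sum_(1 <= n < K.+1) \sum_(1 <= d < n.+1 | (d %| n)%N) F d n =
  \sum_(1 <= d < K.+1) \sum_(1 <= m < (K %/ d).+1) F d (d * m)%N.
Proof.
transitivity (\sum_(1 <= n < K.+1) \sum_(1 <= d < K.+1 | (d %| n)%N) F d n).
  apply: eq_big_nat => n /andP[n1 nK].
  rewrite (big_nat_widen _ _ K.+1)//; apply: eq_bigl => d.
  by case: (boolP (d %| n)%N) => //= dn; rewrite ltnS dvdn_leq.
rewrite (exchange_big_dep xpredT)//=; apply: eq_big_nat => d /andP[d1 _].
exact: sum_multiples.
Qed.

(** The indicator of gcd(a, q) = 1 is the sum of mu(d) over d dividing both a and q; after the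
    exchange, each d | q has q / d multiples up to q. *)
Lemma sum_coprime (q : nat) : (0 < q)%N ->
  (\sum_(1 <= a < q.+1 | coprime a q) 1 : R) =
  \sum_(1 <= d < q.+1 | (d %| q)%N) mobius d * (q %/ d)%:R.
Proof.
move=> q0.
transitivity (\sum_(1 <= a < q.+1)
    \sum_(1 <= d < q.+1 | ((d %| q) && (d %| a))%N) mobius d).
  rewrite big_mkcond; apply: eq_big_nat => a /andP[a1 aq].
  have g0 : (0 < gcdn a q)%N by rewrite gcdn_gt0 a1.
  transitivity (\sum_(1 <= d < (gcdn a q).+1 | (d %| gcdn a q)%N) mobius d).
    by rewrite sum_mobius_dvd// /coprime; case: eqP.
  rewrite (big_nat_widen _ _ q.+1); last by rewrite ltnS dvdn_leq// dvdn_gcdr.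
  apply: eq_bigl => d; rewrite dvdn_gcd [in RHS]andbC.
  case: (boolP ((d %| a) && (d %| q))%N) => //= /andP[da dq].
  by rewrite ltnS dvdn_leq// dvdn_gcd da.
rewrite (exchange_big_dep (fun d => d %| q)%N)//=; last by move=> ? ? _ /andP[].
rewrite big_seq_cond [RHS]big_seq_cond; apply: eq_bigr => d.
rewrite mem_index_iota => /andP[/andP[d1 _] dq].
rewrite (eq_bigl (fun a => d %| a)%N); last by move=> a; rewrite dq.
by rewrite sum_multiples// sumr_const_nat subn1 mulr_natr.
Qed.

End Mobius.

Lemma mobius_norm_le1 (R : realDomainType) (n : nat) : `|mobius R n| <= 1.
Proof.
rewrite /mobius; elim: (primes n) => [|p s IH]; first by rewrite big_nil normr1.
rewrite big_cons normrM mulr_ile1//.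
by case: ifP; rewrite ?normrN1 ?normr0.
Qed.

(** * Riemann sums for the quarter disk *)

Section CircleArea.
Variable R : realType.

Lemma derive_ge0_le (f df : R -> R) (a b : R) : a <= b ->
  (forall x : R, is_derive x 1 f (df x)) ->
  (forall x, a < x < b -> 0 <= df x) -> f a <= f b.
Proof.
move=> ab fE df0; apply: (@ger0_derive1_ndecr R f a b) => // [x|].
- by rewrite in_itv/= derive1E derive_val; apply: df0.
- by apply: continuous_subspaceT => x; exact/differentiable_continuous/derivable1_diffP.
Qed.

Lemma sin_le (x : R) : 0 <= x -> sin x <= x.
Proof.
move=> x0; rewrite -subr_ge0 -[leLHS](_ : 0 - sin 0 = 0); last by rewrite sin0 subrr.
by apply: (@derive_ge0_le (fun x => x - sin x) (fun x => 1 - cos x)).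
Qed.

Lemma mul_cos_le_sin (x : R) : 0 <= x <= pi / 2 -> x * cos x <= sin x.
Proof.
move=> /andP[x0 xpi].
rewrite -subr_ge0 -[leLHS](_ : sin 0 - 0 * cos 0 = 0); last by rewrite sin0 mul0r subrr.
apply: (@derive_ge0_le (fun x => sin x - x * cos x) (fun x => x * sin x)) => //.
  move=> y; apply: is_derive_eq; rewrite !scaler1 /GRing.scale/=; ring.
move=> y /andP[y0 yx]; rewrite mulr_ge0 ?(ltW y0)// sin_ge0_pi// ltW//=.
have := pi_gt0 R; lra.
Qed.

(* The area under y = sqrt(1 - x^2) over [0, sin t]; parametrising by the angle
   keeps the primitive differentiable at the end point x = 1. *)
Definition half_sector (t : R) : R := (t + sin t * cos t) / 2.

(** The strip over [sin s, sin t] lies between rectangles of heights cos t and cos s. Each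
    difference vanishes at t = s and has a nonnegative derivative in t. *)
Lemma half_sector_diff (s t : R) : 0 <= s -> s <= t -> t <= pi / 2 ->
  (sin t - sin s) * cos t <= half_sector t - half_sector s <= (sin t - sin s) * cos s.
Proof.
move=> s0 st tpi; have sinmono x : s < x < t -> 0 <= sin x - sin s.
  move=> /andP[sx xt]; rewrite subr_ge0 ltW// ltr_sin// in_itv/=; apply/andP; split; lra.
have cosmono x : s < x < t -> 0 <= cos s - cos x.
  move=> /andP[sx xt]; rewrite subr_ge0 ltW// ltr_cos// in_itv/=; apply/andP; split; lra.
apply/andP; split; rewrite -subr_ge0.
  rewrite -[leLHS](_ : half_sector s - half_sector s
    - (sin s - sin s) * cos s = 0); last by ring.
  apply: (@derive_ge0_le
    (fun t => half_sector t - half_sector s - (sin t - sin s) * cos t)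
    (fun t => (sin t - sin s) * sin t)) => // x.
    rewrite /half_sector; apply: is_derive_eq; rewrite /GRing.scale/=.
    by rewrite -[X in 2^-1 * (X + _)](cos2Dsin2 x); field.
  move=> sxt; rewrite mulr_ge0 ?sinmono// sin_ge0_pi//.
  move: sxt => /andP[]; have := pi_gt0 R; lra.
rewrite -[leLHS](_ : (sin s - sin s) * cos s
  - (half_sector s - half_sector s) = 0); last by ring.
apply: (@derive_ge0_le
    (fun t => (sin t - sin s) * cos s - (half_sector t - half_sector s))
    (fun t => cos t * (cos s - cos t))) => // x.
  rewrite /half_sector; apply: is_derive_eq; rewrite /GRing.scale/=.
  by rewrite -[X in 2^-1 * (X + _)](cos2Dsin2 x); field.
move=> sxt; rewrite mulr_ge0 ?cosmono// cos_ge0_pihalf//.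
move: sxt => /andP[]; have := pi_gt0 R; lra.
Qed.

(** A sum over right end points; terms with h m > 1 vanish because [Num.sqrt] is 0 on negative
    numbers. *)
Definition semicircle_sum (h : R) (M : nat) : R :=
  \sum_(1 <= m < M.+1) h * Num.sqrt (1 - (h * m%:R) ^+ 2).

(** The rectangles are inscribed, since the curve decreases. Shifted one step to the right they
    cover everything but the first strip, of area at most h. The hypothesis on M makes the nodes
    reach 1. *)
Lemma semicircle_sum_bounds (h : R) (M : nat) : 0 < h -> 1 <= M.+1%:R * h ->
  pi / 4 - h <= semicircle_sum h M <= pi / 4.
Proof.
move=> h0 Mh; rewrite /semicircle_sum.
(* Nodes are capped at 1 to stay in the domain of [asin]; beyond the cap both sides of [cost] are
   0. *)
pose x m : R := Num.min 1 (h * m%:R); pose t m := asin (x m).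
have x01 m : 0 <= x m <= 1.
  by rewrite /x le_min ler01 mulr_ge0 ?ler0n ?(ltW h0)//= ge_min lexx.
have xN11 m : -1 <= x m <= 1 by have := x01 m; lra.
have xS m : x m <= x m.+1 <= x m + h.
  rewrite /x -[m.+1]addn1 natrD mulrDr mulr1.
  by case: (leP 1 (h * m%:R)) => ?; case: (leP 1 (_ + h)) => ?; lra.
have sint m : sin (t m) = x m by rewrite asinK// in_itv/=; exact: xN11.
have cost m : cos (t m) = Num.sqrt (1 - (h * m%:R) ^+ 2).
  rewrite cos_asin// /x; case: (leP 1 _) => // hm.
  rewrite expr1n subrr sqrtr0 ler0_sqrtr// subr_le0; nra.
have t0 m : 0 <= t m.
  rewrite leNgt; apply/negP => tm; have : sin (t m) < sin 0.
    rewrite ltr_sin// in_itv/= ?asin_geNpi2// ?asin_lepi2//.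
    by have := pi_gt0 R; lra.
  by rewrite sin0 sint; have := x01 m; lra.
have tS m : t m <= t m.+1.
  rewrite leNgt; apply/negP => tm; have : sin (t m.+1) < sin (t m).
    by rewrite ltr_sin// in_itv/= ?asin_geNpi2// ?asin_lepi2.
  by rewrite !sint; have := xS m; lra.
have step m := half_sector_diff (t0 m) (tS m) (asin_lepi2 (xN11 m.+1)).
have ht0 : half_sector (t 0%N) = 0.
  have -> : t 0%N = 0.
    rewrite /t /x mulr0 min_r// -[X in asin X]sin0 sinK// in_itv/=.
    by have := pi_gt0 R; lra.
  by rewrite /half_sector sin0 mul0r addr0 mul0r.
have hpi : half_sector (pi / 2) = pi / 4.
  rewrite /half_sector cos_pihalf mulr0 addr0; lra.
have htM : half_sector (t M.+1) = pi / 4.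
  rewrite /t /x min_l; last by rewrite mulrC.
  by rewrite -hpi -[X in asin X]sin_pihalf sinK// in_itv/=; have := pi_gt0 R; lra.
have hle m : half_sector (t m) <= pi / 4.
  have /andP[+ _] := half_sector_diff (t0 m) (asin_lepi2 (xN11 m)) (lexx _).
  by rewrite cos_pihalf mulr0 hpi subr_ge0.
apply/andP; split; last first.
  apply: le_trans (hle M).
  rewrite -[leRHS]subr0 -[X in _ <= _ - X]ht0.
  rewrite -(@telescope_sumr _ _ _ (fun m => half_sector (t m)))// big_add1/=.
  apply: ler_sum_nat => m _; have /andP[+ _] := step m; apply: le_trans.
  rewrite !sint cost; have := xS m; rewrite /x; case: (leP 1 (h * m.+1%:R)) => hm.
    rewrite ler0_sqrtr ?mulr0//; nra.
  case: (leP 1 _) => hm' xx; first lra.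
  rewrite ler_wpM2r// ?sqrtr_ge0// -[m.+1]addn1 natrD mulrDr; lra.
rewrite lerBlDr -htM -[leLHS]subr0 -[X in _ - X <= _]ht0.
rewrite -(@telescope_sumr _ _ _ (fun m => half_sector (t m)))// big_nat_recl//= big_add1/=.
have h1 : half_sector (t 1%N) - half_sector (t 0%N) <= h.
  have /andP[_ /le_trans] := step 0%N; apply.
  rewrite !sint cost mulr0 expr0n subr0 sqrtr1 mulr1; have := xS 0%N; lra.
rewrite addrC lerD//; apply: ler_sum_nat => m _.
have /andP[_ /le_trans] := step m.+1; apply.
rewrite !sint cost ler_wpM2r ?sqrtr_ge0//; have := xS m.+1; lra.
Qed.

End CircleArea.

(** * The Basel sum with a rate of convergence *)

Section Basel.
Variable R : realType.

Definition sum_inv_sin2 (N : nat) : R :=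
  \sum_(1 <= k < N) sin (k%:R * (pi / (2 * N%:R))) ^- 2.

Lemma angle_bounds (N k : nat) : (1 <= k < N)%N ->
  0 < k%:R * (pi / (2 * N%:R) : R) < pi / 2.
Proof.
move=> /andP[k1 kN]; have N0 : 0 < N%:R :> R by rewrite ltr0n (leq_trans _ kN).
have p0 := pi_gt0 R; have kN' : k%:R < N%:R :> R by rewrite ltr_nat.
have k0 : 0 < k%:R :> R by rewrite ltr0n.
rewrite mulr_gt0 ?divr_gt0 ?mulr_gt0//=.
by rewrite mulrA ltr_pdivrMr ?mulr_gt0//; nra.
Qed.

(** Duplication leads to a sum over angles in (0, pi), which the reflection x -> pi - x folds into
    two copies of the sum for N plus the middle term 1. *)
Lemma sum_inv_sin2_double (N : nat) : (0 < N)%N ->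
  sum_inv_sin2 (2 * N) = 4 * sum_inv_sin2 N + 2.
Proof.
move=> N0; have N0' : N%:R != 0 :> R by rewrite pnatr_eq0 -lt0n.
pose b k : R := sin (k%:R * (pi / (2 * N%:R))) ^- 2.
(* 1/sin^2 x + 1/cos^2 x = 4/sin^2 (2x), summed over x and pi/2 - x *)
have duplication : 2 * sum_inv_sin2 (2 * N) = 4 * \sum_(1 <= k < 2 * N) b k.
  rewrite mulr2n mulrDl !mul1r {2}/sum_inv_sin2 big_nat_rev/= -big_split/= mulr_sumr.
  apply: eq_big_nat => k kN; rewrite add1n subSS.
  have := angle_bounds kN; set x : R := k%:R * _ => x0.
  have -> : (2 * N - k)%:R * (pi / (2 * (2 * N)%:R)) = pi / 2 - x.
    rewrite /x natrB; last by case/andP: kN => _ /ltnW.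
    by rewrite natrM; field.
  have sx : 0 < sin x by apply: sin_gt0_pihalf.
  have cx : 0 < cos x by apply: cos_gt0_pihalf; have := pi_gt0 R; lra.
  rewrite sinB sin_pihalf cos_pihalf mul0r subr0 mul1r /b.
  have -> : k%:R * (pi / (2 * N%:R)) = x *+ 2.
    by rewrite /x natrM mulr2n; field.
  rewrite sin_mulr2n mulr2n.
  have := cos2Dsin2 x; move: (sin x) (cos x) sx cx => s c s0 c0 cs.
  by rewrite -[1 in RHS]cs; field; rewrite !gt_eqF ?addr_gt0 ?mulr_gt0.
have reflection : \sum_(N.+1 <= k < 2 * N) b k = sum_inv_sin2 N.
  rewrite -[N.+1]add1n big_addn mul2n -addnn addnK big_nat_rev/=.
  apply: eq_big_nat => k /andP[k1 kN].
  rewrite add1n subSS /b.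
  have -> : (N - k + N)%:R * (pi / (2 * N%:R)) = pi - k%:R * (pi / (2 * N%:R)) :> R.
    by rewrite natrD natrB ?(ltnW kN)//; field.
  by rewrite sinB sinpi cospi mul0r sub0r mulN1r opprK.
have middle : b N = 1.
  rewrite /b (_ : N%:R * _ = pi / 2); last by field.
  by rewrite sin_pihalf expr1n invr1.
have : \sum_(1 <= k < 2 * N) b k = 2 * sum_inv_sin2 N + 1.
  rewrite (big_cat_nat (n := N))//=; last by lia.
  rewrite [X in _ + X]big_ltn; last by lia.
  rewrite reflection middle /sum_inv_sin2 -/b; ring.
lra.
Qed.

Lemma sum_inv_sin2_expn2 (n : nat) :
  sum_inv_sin2 (2 ^ n) = 2 / 3 * ((2 ^ n)%:R ^+ 2 - 1).
Proof.
elim: n => [|n IH]; first by rewrite expn0 /sum_inv_sin2 big_geq// expr1n subrr mulr0.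
rewrite expnS sum_inv_sin2_double ?expn_gt0// IH natrM; lra.
Qed.

(** This is sin x <= x <= tan x, squared and inverted, with cot^2 = 1/sin^2 - 1. *)
Lemma inv_sqr_bounds (x : R) : 0 < x < pi / 2 ->
  sin x ^- 2 - 1 <= x ^- 2 <= sin x ^- 2.
Proof.
move=> x0; have s0 := sin_gt0_pihalf x0.
have c0 : 0 < cos x by apply: cos_gt0_pihalf; have := pi_gt0 R; lra.
have xs : sin x <= x by apply: sin_le; lra.
have xc : x * cos x <= sin x by apply: mul_cos_le_sin; lra.
have x00 : 0 < x by lra.
apply/andP; split; last by rewrite lef_pV2 ?posrE ?exprn_gt0// ler_pXn2r ?nnegrE// ltW.
have -> : sin x ^- 2 - 1 = (cos x / sin x) ^+ 2.
  by rewrite expr_div_n cos2sin2; field; rewrite gt_eqF.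
rewrite -exprVn ler_pXn2r ?nnegrE ?divr_ge0 ?invr_ge0 ?(ltW s0) ?(ltW c0) ?(ltW x00)//.
by rewrite ler_pdivrMr// ler_pdivlMl.
Qed.

Lemma basel_expn2 (n : nat) :
  pi ^+ 2 / 6 - pi ^+ 2 / (4 * (2 ^ n)%:R) <=
  \sum_(1 <= k < 2 ^ n) (k%:R : R) ^- 2 <= pi ^+ 2 / 6.
Proof.
set N := (2 ^ n)%N; have N0 : 0 < N%:R :> R by rewrite ltr0n expn_gt0.
have N1 : 1 <= N%:R :> R by rewrite ler1n expn_gt0.
have p0 := pi_gt0 R.
set c : R := pi ^+ 2 / (4 * N%:R ^+ 2).
have c0 : 0 < c by rewrite divr_gt0 ?mulr_gt0 ?exprn_gt0.
have -> : \sum_(1 <= k < N) (k%:R : R) ^- 2 =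
    c * \sum_(1 <= k < N) (k%:R * (pi / (2 * N%:R))) ^- 2.
  rewrite mulr_sumr; apply: eq_big_nat => k /andP[k1 _].
  rewrite /c; move: (pi) p0 => p p0; field.
  by rewrite (gt_eqF N0) (gt_eqF p0)/= pnatr_eq0 -lt0n.
have TN := sum_inv_sin2_expn2 n; rewrite -/N in TN.
apply/andP; split.
  apply: (@le_trans _ _ (c * (sum_inv_sin2 N - (N%:R - 1)))).
    (* Exactly, c (2/3 (N^2 - 1) - (N - 1)) = pi^2/6 - pi^2/(4 N) + c/3. *)
    rewrite TN -subr_ge0 (_ : _ - _ = c * 3^-1); first by rewrite mulr_ge0 ?ltW.
    by rewrite /c; field; rewrite gt_eqF.
  have -> : sum_inv_sin2 N - (N%:R - 1) =
      \sum_(1 <= k < N) (sin (k%:R * (pi / (2 * N%:R))) ^- 2 - 1).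
    by rewrite sumrB sumr_const_nat natrB ?expn_gt0.
  rewrite ler_pM2l//.
  by apply: ler_sum_nat => k /angle_bounds/inv_sqr_bounds/andP[].
apply: (@le_trans _ _ (c * sum_inv_sin2 N)).
  rewrite ler_pM2l//; apply: ler_sum_nat => k /angle_bounds/inv_sqr_bounds/andP[] //.
rewrite TN -subr_ge0 (_ : _ - _ = c * (2 / 3)); last first.
  by rewrite /c; field; rewrite gt_eqF.
by rewrite mulr_ge0// ltW.
Qed.

(** Partial sums increase, so M + 1 may be replaced by the powers of 2 around it; 2^n >= (M + 1)/2
    turns the 4 of the dyadic bound into a 2. *)
Lemma basel_rate (M : nat) :
  pi ^+ 2 / 6 - pi ^+ 2 / (2 * M.+1%:R) <=
  \sum_(1 <= k < M.+1) (k%:R : R) ^- 2 <= pi ^+ 2 / 6.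
Proof.
set n := trunc_log 2 M.+1; have /andP[nM Mn] : (2 ^ n <= M.+1 < 2 ^ n.+1)%N.
  exact: trunc_log_bounds.
have mono a b : (a <= b)%N -> (0 < a)%N ->
    \sum_(1 <= k < a) (k%:R : R) ^- 2 <= \sum_(1 <= k < b) (k%:R : R) ^- 2.
  by move=> ab a0; rewrite [leRHS](big_cat_nat (n := a))//= lerDl sumr_ge0.
apply/andP; split; last first.
  by apply: le_trans (mono _ _ (ltnW Mn) _) _ => //; case/andP: (basel_expn2 n.+1).
apply: le_trans (mono _ _ nM _); last by rewrite expn_gt0.
case/andP: (basel_expn2 n) => + _; apply: le_trans.
rewrite lerD2l lerN2 ler_pM2l ?exprn_gt0 ?pi_gt0//.
have h1 : 0 < (2 ^ n)%:R :> R by rewrite ltr0n expn_gt0.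
rewrite lef_pV2 ?posrE ?mulr_gt0 ?ltr0n ?expn_gt0//.
have : M.+1%:R <= (2 ^ n.+1)%:R :> R by rewrite ler_nat ltnW.
rewrite expnS natrM; lra.
Qed.

End Basel.

(** * The Ford length as a Moebius-weighted sum *)

Section FordLength.
Variable R : realType.

(** Each new term is at most the increment of ln, by ln(1 + x) <= x at x = -1/(N + 2). *)
Lemma harmonic_le (N : nat) : (0 < N)%N ->
  \sum_(1 <= d < N.+1) (d%:R : R)^-1 <= 1 + ln N%:R.
Proof.
case: N => // N _; elim: N => [|N IH]; first by rewrite big_nat1 invr1 ln1 addr0.
rewrite big_nat_recr//=; apply: le_trans (lerD IH (lexx _)) _.
rewrite -addrA lerD2l -lerBrDl.
have N0 : 0 < N.+1%:R :> R by rewrite ltr0n.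
have N20 : 0 < N.+2%:R :> R by rewrite ltr0n.
suff : ln (N.+1%:R / N.+2%:R) <= - N.+2%:R^-1 :> R.
  by rewrite ln_div ?posrE// => le; rewrite -lerN2 opprB.
have -> : N.+1%:R / N.+2%:R = 1 + - (N.+2%:R^-1) :> R.
  by rewrite -[N.+1%:R](addrK 1) natr1 mulrBl mulfV ?gt_eqF// div1r.
by apply: le_ln1Dx; rewrite ltrN2 invf_lt1// ltr1n.
Qed.

Lemma chord_lengthE (eps : R) (q : nat) : 0 < eps -> (0 < q)%N ->
  chord_length eps q =
  2 * (Num.sqrt eps / q%:R) * Num.sqrt (1 - (Num.sqrt eps * q%:R) ^+ 2).
Proof.
move=> e0 q0; have q0' : 0 < q%:R :> R by rewrite ltr0n.
rewrite /chord_length /ford_radius exprMn sqr_sqrtr ?(ltW e0)//.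
have -> : (2 * q%:R ^+ 2)^-1 ^+ 2 - (eps - (2 * q%:R ^+ 2)^-1) ^+ 2 =
    eps * q%:R ^- 2 * (1 - eps * q%:R ^+ 2) :> R.
  by field; rewrite gt_eqF.
rewrite sqrtrM; last by rewrite mulr_ge0 ?(ltW e0).
by rewrite sqrtrM ?(ltW e0)// -exprVn sqrtr_sqr ger0_norm ?invr_ge0 ?(ltW q0')// mulrA.
Qed.

Lemma ford_lengthE (eps : R) (K := Num.truncn eps^-1) : 0 < eps ->
  ford_length eps = 2 * \sum_(1 <= d < K.+1)
    mobius R d * d%:R ^- 2 * semicircle_sum (Num.sqrt eps * d%:R) (K %/ d).
Proof.
move=> e0.
transitivity (\sum_(1 <= q < K.+1) \sum_(1 <= d < q.+1 | (d %| q)%N)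
    mobius R d * (q %/ d)%:R * chord_length eps q).
  rewrite /ford_length -/K big_mkcond; apply: eq_big_nat => q /andP[q1 _].
  rewrite -[RHS]mulr_suml -sum_coprime// mulr_suml.
  case: ifPn => [_|]; first by apply: eq_bigr => a _; rewrite mul1r.
  rewrite -ltNge => qe; rewrite big1// => a _; rewrite mul1r chord_lengthE//.
  rewrite [X in _ * X]ler0_sqrtr ?mulr0// exprMn sqr_sqrtr ?(ltW e0)// subr_le0.
  by rewrite -ler_pdivrMl// mulr1 ltW.
rewrite (sum_multiples_exchange
  (fun d q => mobius R d * (q %/ d)%:R * chord_length eps q)).
rewrite mulr_sumr; apply: eq_big_nat => d /andP[d1 _].
rewrite /semicircle_sum !mulr_sumr; apply: eq_big_nat => m /andP[m1 _].
rewrite mulKn// chord_lengthE ?muln_gt0 ?d1// natrM [_ * (d%:R * _)]mulrA.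
by field; rewrite !pnatr_eq0 -!lt0n d1.
Qed.

(** An error linear in d costs only a harmonic sum, as |mu| <= 1. *)
Lemma mobius_weighted_sum_le (e : nat -> R) (A : R) (K : nat) :
  (forall d, (1 <= d < K.+1)%N -> `|e d| <= A * d%:R) ->
  `|\sum_(1 <= d < K.+1) mobius R d * d%:R ^- 2 * e d| <=
  A * \sum_(1 <= d < K.+1) (d%:R)^-1.
Proof.
move=> eA; apply: le_trans (ler_norm_sum _ _ _) _.
rewrite mulr_sumr; apply: ler_sum_nat => d dK.
have d0 : 0 < d%:R :> R by rewrite ltr0n; case/andP: dK.
rewrite 2!normrM -[leRHS](_ : 1 * d%:R ^- 2 * (A * d%:R) = _); last first.
  by field; rewrite gt_eqF.
rewrite ler_pM ?mulr_ge0 ?eA// ler_pM ?mobius_norm_le1//.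
by rewrite ger0_norm// invr_ge0 exprn_ge0 ?ltW.
Qed.

(** Grouping by n = d m, the divisor sum of mu leaves only n = 1. *)
Lemma mobius_basel_sum (K : nat) : (0 < K)%N ->
  \sum_(1 <= d < K.+1) mobius R d * d%:R ^- 2 *
    (\sum_(1 <= m < (K %/ d).+1) m%:R ^- 2) = 1.
Proof.
move=> K0; transitivity (\sum_(1 <= n < K.+1) \sum_(1 <= d < n.+1 | (d %| n)%N)
    mobius R d * n%:R ^- 2).
  rewrite (sum_multiples_exchange (fun d n => mobius R d * n%:R ^- 2)).
  apply: eq_big_nat => d _; rewrite mulr_sumr; apply: eq_big_nat => m _.
  by rewrite natrM exprMn -mulrA -invfM.
rewrite big_ltn//= [X in _ + X]big_nat [X in _ + X]big1.
  by rewrite addr0 -mulr_suml sum_mobius_dvd// eqxx expr1n invr1 mulr1.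
move=> n /andP[n2 _]; rewrite -mulr_suml sum_mobius_dvd; last exact: ltnW.
by rewrite gtn_eqF// mul0r.
Qed.

Lemma harmonic_truncn_le (eps : R) : 0 < eps -> eps <= 1 / 2 ->
  \sum_(1 <= d < (Num.truncn eps^-1).+1) (d%:R : R)^-1 <= 3 * `|ln eps|.
Proof.
move=> e0 e2; have ei0 : 0 < eps^-1 by rewrite invr_gt0.
have ei1 : 1 <= eps^-1 by rewrite invf_ge1//; lra.
have K0 : (0 < Num.truncn eps^-1)%N by rewrite truncn_gt0.
(* Thus 1 <= 2 |ln eps|, which absorbs the constant of the harmonic bound. *)
have lne : ln eps <= - (1 / 2).
  apply: le_trans (_ : ln (1 / 2) <= _); first by rewrite ler_ln ?posrE//; lra.
  rewrite (_ : 1 / 2 = 1 + - (1 / 2)); last by lra.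
  by apply: le_trans (le_ln1Dx _) _; lra.
apply: le_trans (harmonic_le K0) _.
apply: le_trans (_ : 1 + ln eps^-1 <= _).
  by rewrite lerD2l ler_ln ?posrE ?ltr0n// truncn_le// ltW.
rewrite lnV ?posrE// ler0_norm; lra.
Qed.

End FordLength.

(** * Combining the error terms *)

Theorem theorem5 (R : realType) :
  exists C : R, forall eps : R, 0 < eps -> eps <= 1 / 2 ->
    `|ford_length eps - 3 / pi| <= C * (Num.sqrt eps * `|ln eps|).
Proof.
(* 24 = (2 + 6) * 3: the constants of [semicircle] and [mertens], times that of the harmonic
   bound. *)
exists 24 => eps e0 e2.
set K := Num.truncn eps^-1; set delta := Num.sqrt eps.
have d0 : 0 < delta by rewrite sqrtr_gt0.
have dd : delta ^+ 2 = eps by rewrite sqr_sqrtr ?ltW.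
have dle1 : delta <= 1 by nra.
have K0 : (0 < K)%N by rewrite truncn_gt0 invf_ge1//; lra.
(* Since (K/d + 1) d >= K + 1 > 1/eps, this gives both the reach of the Riemann sums, as eps <=
   delta, and the Basel error O(eps d). *)
have Kd d : (1 <= d < K.+1)%N -> 1 <= (K %/ d).+1%:R * (eps * d%:R).
  move=> /andP[d1 _]; have : (K.+1 <= (K %/ d).+1 * d)%N by rewrite ltn_ceil.
  rewrite -(ler_nat R) natrM => KM.
  have : eps^-1 < K.+1%:R by rewrite truncnS_gt.
  rewrite -(ltr_pM2l e0) mulfV ?gt_eqF// => eK.
  apply: le_trans (ltW eK) _; rewrite mulrCA ler_pM2l//.
have H := harmonic_truncn_le e0 e2; rewrite -/K in H.
set Hs := \sum_(1 <= d < K.+1) _ in H.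
pose Mo := \sum_(1 <= d < K.+1) mobius R d * d%:R ^- 2.
have Hs0 : 0 <= Hs by apply: sumr_ge0 => d _; rewrite invr_ge0.
have p0 := pi_gt0 R; have p4 : pi < 4 :> R by have := pihalf_lt2 R; lra.
have semicircle : `|ford_length eps - pi / 2 * Mo| <= 2 * delta * Hs.
  rewrite ford_lengthE// -/K -/delta.
  rewrite (_ : _ - _ = 2 * \sum_(1 <= d < K.+1) mobius R d * d%:R ^- 2 *
    (semicircle_sum (delta * d%:R) (K %/ d) - pi / 4)); last first.
    under [in RHS]eq_bigr do rewrite mulrBr.
    rewrite sumrB -mulr_suml -/Mo; lra.
  rewrite normrM ger0_norm// -mulrA ler_pM2l//; apply: mobius_weighted_sum_le => d dK.
  have dp : 0 < d%:R :> R by rewrite ltr0n; case/andP: dK.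
  have : 1 <= (K %/ d).+1%:R * (delta * d%:R).
    apply: le_trans (Kd d dK) _; rewrite ler_pM2l// ler_pM2r// -dd; nra.
  move=> /(semicircle_sum_bounds (mulr_gt0 d0 dp)); rewrite ler_norml.
  by have := mulr_gt0 d0 dp; lra.
(* The truncated Basel sums in the exact identity are replaced by pi^2/6. *)
have basel : `|1 - pi ^+ 2 / 6 * Mo| <= pi ^+ 2 / 2 * eps * Hs.
  rewrite -[X in `|X - _|](mobius_basel_sum R K0).
  rewrite (_ : _ - _ = \sum_(1 <= d < K.+1) mobius R d * d%:R ^- 2 *
    (\sum_(1 <= m < (K %/ d).+1) m%:R ^- 2 - pi ^+ 2 / 6)); last first.
    under [in RHS]eq_bigr do rewrite mulrBr.
    by rewrite sumrB -mulr_suml -/Mo [Mo * _]mulrC.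
  apply: mobius_weighted_sum_le => d dK.
  have := basel_rate R (K %/ d); have := Kd d dK.
  set S := \sum_(_ <= _ < _) _; set M : R := (K %/ d).+1%:R => M1 SM.
  have M0 : 0 < M by rewrite ltr0n.
  have MT : pi ^+ 2 / (2 * M) <= pi ^+ 2 / 2 * eps * d%:R.
    rewrite invfM mulrA -[leRHS]mulrA ler_pM2l ?divr_gt0 ?exprn_gt0//.
    by rewrite -[M^-1]mulr1 ler_pdivrMl.
  case/andP: SM => SM1 SM2; rewrite ler_norml; apply/andP; split.
    by rewrite lerNl opprB lerBlDl -lerBlDr (le_trans _ SM1)// lerD2l lerN2.
  by rewrite (le_trans (_ : _ <= 0)) ?subr_le0// !mulr_ge0// ltW.
(* Multiplying [basel] by 3/pi gives the factor 3 pi/2 * eps, at most 6 delta because pi < 4 and eps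
   <= delta. *)
have mertens : `|pi / 2 * Mo - 3 / pi| <= 6 * delta * Hs.
  rewrite distrC (_ : _ - _ = 3 / pi * (1 - pi ^+ 2 / 6 * Mo)); last first.
    by move: (pi) p0 => p p0; field; rewrite gt_eqF.
  rewrite normrM ger0_norm ?divr_ge0 ?(ltW p0)//.
  apply: (@le_trans _ _ (3 / pi * (pi ^+ 2 / 2 * eps * Hs))).
    by rewrite ler_pM2l ?divr_gt0.
  rewrite (_ : 3 / pi * _ = 3 / 2 * pi * eps * Hs); last first.
    by move: (pi) p0 => p p0; field; rewrite gt_eqF.
  rewrite ler_wpM2r//; apply: (@le_trans _ _ (6 * eps)).
    by rewrite ler_pM2r//; lra.
  by rewrite ler_pM2l// -dd expr2 ger_pMl.
apply: le_trans (ler_distD (pi / 2 * Mo) _ _) _.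
apply: le_trans (lerD semicircle mertens) _.
rewrite -mulrDl (_ : 24 * _ = (2 * delta + 6 * delta) * (3 * `|ln eps|)); last by ring.
by rewrite ler_wpM2l//; lra.
Qed.
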